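(* Let $M$ be a closed FPC term of type $\tau$. If $M\to^k N$ (with $k\in\{0,1\}$), then $\llbracket M\rrbracket( * )=\delta_\tau^k(\llbracket N\rrbracket( * ))$.
   Context: All reasoning takes place inside Guarded Dependent Type Theory (GDTT), an extensional dependent type theory with identity types (written $=$), a universe $\mathcal U$, and guarded recursion relative to an implicit clock $\kappa$: a type former $\triangleright A$ (''later $A$''), a map $\mathrm{next}:A\to\triangleright A$, later application $\circledast:\triangleright(A\to B)\to\triangleright A\to\triangleright B$ with $\mathrm{next}(f)\circledast\mathrm{next}(t)=\mathrm{next}(f(t))$, a fixed point combinator $\mathrm{fix}:(\triangleright A\to A)\to A$ with $\mathrm{fix}(f)=f(\mathrm{next}(\mathrm{fix}(f)))$, and solutions to guarded recursive type equations. FPC: types $\tau::=\alpha\mid 1\mid \tau_1+\tau_2\mid\tau_1\times\tau_2\mid\tau_1\to\tau_2\mid\mu\alpha.\tau$; terms $\langle\rangle, x, \mathrm{inl}\,M,\mathrm{inr}\,M,\mathrm{case}\,L\,\mathrm{of}\,x_1.M;x_2.N,\langle M,N\rangle,\mathrm{fst}\,M,\mathrm{snd}\,M,\lambda x{:}\tau.M, MN,\mathrm{fold}\,M,\mathrm{unfold}\,M$ with standard simple typing; $\mathrm{fold}\,M:\mu\alpha.\tau$ when $M:\tau[\mu\alpha.\tau/\alpha]$, and $\mathrm{unfold}\,M:\tau[\mu\alpha.\tau/\alpha]$ when $M:\mu\alpha.\tau$. Small-step semantics $M\to^k N$ ($k\in\{0,1\}$): $(\lambda x.M)N\to^0 M[N/x]$;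 $\mathrm{case}\,(\mathrm{inl}\,L)\,\mathrm{of}\,x_1.M;x_2.N\to^0 M[L/x_1]$; $\mathrm{case}\,(\mathrm{inr}\,L)\,\mathrm{of}\,x_1.M;x_2.N\to^0 N[L/x_2]$; $\mathrm{fst}\langle M,N\rangle\to^0 M$; $\mathrm{snd}\langle M,N\rangle\to^0N$; $\mathrm{unfold}(\mathrm{fold}\,M)\to^1 M$; and if $M_1\to^kM_2$ then $E[M_1]\to^kE[M_2]$ for evaluation contexts $E::=[\cdot]\mid E\,M\mid \mathrm{case}\,E\,\mathrm{of}\,x_1.M;x_2.N\mid\mathrm{fst}\,E\mid\mathrm{snd}\,E\mid\mathrm{unfold}\,E$. Denotational semantics: for a small type $A$, $LA$ is the guarded recursive type with $LA\cong A+\triangleright LA$, with injections $\eta:A\to LA$ and $\theta_{LA}:\triangleright LA\to LA$. For $f:A\to B$ where $B$ has a map $\theta_B:\triangleright B\to B$, $\hat f:LA\to B$ is defined by guarded recursion via $\hat f(\eta a)=f(a)$, $\hat f(\theta_{LA} r)=\theta_B(\mathrm{next}(\hat f)\circledast r)$. Closed types: $\llbracket1\rrbracket=L1$, $\llbracket\tau_1\times\tau_2\rrbracket=\llbracket\tau_1\rrbracket\times\llbracket\tau_2\rrbracket$, $\llbracket\tau_1+\tau_2\rrbracket=L(\llbracket\tau_1\rrbracket+\llbracket\tau_2\rrbracket)$, $\llbracket\tau_1\to\tau_2\rrbracket=\llbracket\tau_1\rrbracket\to\llbracket\tau_2\rrbracket$, and (by guarded recursion) $\llbracket\mu\alpha.\tau\rrbracket=\triangleright\llbracket\tau[\mu\alpha.\tau/\alpha]\rrbracket$.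 Maps $\theta_\sigma:\triangleright\llbracket\sigma\rrbracket\to\llbracket\sigma\rrbracket$: $\theta_1=\theta_{L1}$, $\theta_{\tau_1+\tau_2}=\theta_{L(\llbracket\tau_1\rrbracket+\llbracket\tau_2\rrbracket)}$, $\theta_{\tau_1\times\tau_2}(x)=\langle\theta_{\tau_1}(\mathrm{next}(\pi_1)\circledast x),\theta_{\tau_2}(\mathrm{next}(\pi_2)\circledast x)\rangle$, $\theta_{\sigma\to\tau}(f)(x)=\theta_\tau(f\circledast\mathrm{next}(x))$, $\theta_{\mu\alpha.\tau}(x)=\mathrm{next}(\theta_{\tau[\mu\alpha.\tau/\alpha]})\circledast x$. Delay: $\delta_\sigma=\theta_\sigma\circ\mathrm{next}$, and $\delta_\sigma^0$ is the identity. A term $x_1{:}\sigma_1,\dots,x_n{:}\sigma_n\vdash M:\sigma$ denotes $\llbracket M\rrbracket:\llbracket\sigma_1\rrbracket\times\dots\times\llbracket\sigma_n\rrbracket\to\llbracket\sigma\rrbracket$: variables are projections; $\llbracket\langle\rangle\rrbracket\gamma=\eta( * )$; pairing, projections, abstraction, application are the type-theoretic ones; $\llbracket\mathrm{inl}\,M\rrbracket\gamma=\eta(\mathrm{inl}(\llbracket M\rrbracket\gamma))$, $\llbracket\mathrm{inr}\,M\rrbracket\gamma=\eta(\mathrm{inr}(\llbracket M\rrbracket\gamma))$; $\llbracket\mathrm{case}\,L\,\mathrm{of}\,x_1.M;x_2.N\rrbracket\gamma=\hat f(\llbracket L\rrbracket\gamma)$ with $f(\mathrm{inl}\,a)=\llbracket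 M\rrbracket(\gamma,a)$, $f(\mathrm{inr}\,b)=\llbracket N\rrbracket(\gamma,b)$; $\llbracket\mathrm{fold}\,M\rrbracket\gamma=\mathrm{next}(\llbracket M\rrbracket\gamma)$; $\llbracket\mathrm{unfold}\,M\rrbracket\gamma=\theta_{\tau[\mu\alpha.\tau/\alpha]}(\llbracket M\rrbracket\gamma)$ for $M:\mu\alpha.\tau$. For closed $M$, $\llbracket M\rrbracket( * )$ is its value at the empty environment. *)

(* Defs.v *)
(* Guarded Dependent Type Theory is not available natively in
   Rocq; we work internally to an arbitrary *model* of the guarded-recursion
   primitives used in the paper (record [GModel] below), and state the
   soundness theorem for every such model. *)
From Stdlib Require Import List Arith.
Import ListNotations.



(* FPC types, de Bruijn type variables; [TMu a] binds variable 0 in a. *)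
Inductive ty : Set :=
| TVar (n : nat)
| TUnit
| TSum (a b : ty)
| TProd (a b : ty)
| TArr (a b : ty)
| TMu (a : ty).

Fixpoint tlift (k : nat) (t : ty) : ty :=
  match t with
  | TVar n => if n <? k then TVar n else TVar (S n)
  | TUnit => TUnit
  | TSum a b => TSum (tlift k a) (tlift k b)
  | TProd a b => TProd (tlift k a) (tlift k b)
  | TArr a b => TArr (tlift k a) (tlift k b)
  | TMu a => TMu (tlift (S k) a)
  end.

Fixpoint tsubst (k : nat) (s : ty) (t : ty) : ty :=
  match t with
  | TVar n => if n =? k then s else if n <? k then TVar n else TVar (pred n)
  | TUnit => TUnit
  | TSum a b => TSum (tsubst k s a) (tsubst k s b)
  | TProd a b => TProd (tsubst k s a) (tsubst k s b)
  | TArr a b => TArr (tsubst k s a) (tsubst k s b)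
  | TMu a => TMu (tsubst (S k) (tlift 0 s) a)
  end.

Definition unroll (a : ty) : ty := tsubst 0 (TMu a) a.

Fixpoint wf (k : nat) (t : ty) : bool :=
  match t with
  | TVar n => n <? k
  | TUnit => true
  | TSum a b | TProd a b | TArr a b => wf k a && wf k b
  | TMu a => wf (S k) a
  end.

Definition tclosed (t : ty) : Prop := wf 0 t = true.

Inductive var : list ty -> ty -> Type :=
| Vz (G : list ty) (t : ty) : var (t :: G) t
| Vs (G : list ty) (s t : ty) : var G t -> var (s :: G) t.

Inductive tm (G : list ty) : ty -> Type :=
| tUnit : tm G TUnit
| tVar (t : ty) : var G t -> tm G t
| tInl (a b : ty) : tm G a -> tm G (TSum a b)
| tInr (a b : ty) : tm G b -> tm G (TSum a b)
| tCase (a b t : ty) : tm G (TSum a b) -> tm (a :: G) t -> tm (b :: G) t -> tm G t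
| tPair (a b : ty) : tm G a -> tm G b -> tm G (TProd a b)
| tFst (a b : ty) : tm G (TProd a b) -> tm G a
| tSnd (a b : ty) : tm G (TProd a b) -> tm G b
| tLam (a b : ty) : tm (a :: G) b -> tm G (TArr a b)
| tApp (a b : ty) : tm G (TArr a b) -> tm G a -> tm G b
| tFold (a : ty) : tm G (unroll a) -> tm G (TMu a)
| tUnfold (a : ty) : tm G (TMu a) -> tm G (unroll a).

Arguments tUnit {G}.
Arguments tVar {G t}.
Arguments tInl {G a} b.
Arguments tInr {G} a {b}.
Arguments tCase {G a b t}.
Arguments tPair {G a b}.
Arguments tFst {G a b}.
Arguments tSnd {G a b}.
Arguments tLam {G} a {b}.
Arguments tApp {G a b}.
Arguments tFold {G} a.
Arguments tUnfold {G a}.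

Fixpoint closed_tm {G : list ty} {t : ty} (M : tm G t) : Prop :=
  tclosed t /\
  match M with
  | tUnit => True
  | tVar _ => True
  | tInl _ M => closed_tm M
  | tInr _ M => closed_tm M
  | tCase L M N => closed_tm L /\ closed_tm M /\ closed_tm N
  | tPair M N => closed_tm M /\ closed_tm N
  | tFst M => closed_tm M
  | tSnd M => closed_tm M
  | tLam _ M => closed_tm M
  | tApp M N => closed_tm M /\ closed_tm N
  | tFold _ M => closed_tm M
  | tUnfold M => closed_tm M
  end.

Definition var_case {s : ty} {G : list ty} (P : ty -> Type) (z : P s)
  (f : forall t, var G t -> P t) (t : ty) (v : var (s :: G) t) : P t :=
  match v in var D t'
        return match D with
               | nil => unit
               | s' :: G' => P s' -> (forall t'', var G' t'' -> P t'') -> P t'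
               end with
  | @Vz _ _ => fun z _ => z
  | @Vs _ _ _ v' => fun _ f => f _ v'
  end z f.

Definition ren (G D : list ty) := forall t, var G t -> var D t.

Definition lift_ren {G D : list ty} (s : ty) (r : ren G D) : ren (s :: G) (s :: D) :=
  var_case (fun t => var (s :: D) t) (@Vz D s) (fun t v => @Vs _ s _ (r t v)).

Fixpoint rename {G D : list ty} (r : ren G D) {t : ty} (M : tm G t) : tm D t :=
  match M in tm _ t return tm D t with
  | tUnit => tUnit
  | tVar v => tVar (r _ v)
  | tInl b M => tInl b (rename r M)
  | tInr a M => tInr a (rename r M)
  | tCase L M N =>
      tCase (rename r L) (rename (lift_ren _ r) M) (rename (lift_ren _ r) N)
  | tPair M N => tPair (rename r M) (rename r N)
  | tFst M => tFst (rename r M)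
  | tSnd M => tSnd (rename r M)
  | tLam a M => tLam a (rename (lift_ren _ r) M)
  | tApp M N => tApp (rename r M) (rename r N)
  | tFold a M => tFold a (rename r M)
  | tUnfold M => tUnfold (rename r M)
  end.

Definition sub (G D : list ty) := forall t, var G t -> tm D t.

Definition lift_sub {G D : list ty} (s : ty) (sg : sub G D) : sub (s :: G) (s :: D) :=
  var_case (fun t => tm (s :: D) t) (tVar (@Vz D s))
    (fun t v => rename (fun _ w => @Vs _ s _ w) (sg t v)).

Fixpoint subst {G D : list ty} (sg : sub G D) {t : ty} (M : tm G t) : tm D t :=
  match M in tm _ t return tm D t with
  | tUnit => tUnit
  | tVar v => sg _ v
  | tInl b M => tInl b (subst sg M)
  | tInr a M => tInr a (subst sg M)
  | tCase L M N =>
      tCase (subst sg L) (subst (lift_sub _ sg) M) (subst (lift_sub _ sg) N)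
  | tPair M N => tPair (subst sg M) (subst sg N)
  | tFst M => tFst (subst sg M)
  | tSnd M => tSnd (subst sg M)
  | tLam a M => tLam a (subst (lift_sub _ sg) M)
  | tApp M N => tApp (subst sg M) (subst sg N)
  | tFold a M => tFold a (subst sg M)
  | tUnfold M => tUnfold (subst sg M)
  end.

Definition subst1 {G : list ty} {s t : ty} (M : tm (s :: G) t) (N : tm G s) : tm G t :=
  subst (var_case (fun t => tm G t) N (fun t v => tVar v)) M.

(* The evaluation-context rule is given by one congruence rule per
   evaluation-context former  E M | case E of .. | fst E | snd E | unfold E. *)
Inductive step : forall {t : ty}, tm nil t -> nat -> tm nil t -> Prop :=
| st_beta (a b : ty) (M : tm [a] b) (N : tm nil a) :
    step (tApp (tLam a M) N) 0 (subst1 M N)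
| st_case_inl (a b t : ty) (L : tm nil a) (M : tm [a] t) (N : tm [b] t) :
    step (tCase (tInl b L) M N) 0 (subst1 M L)
| st_case_inr (a b t : ty) (L : tm nil b) (M : tm [a] t) (N : tm [b] t) :
    step (tCase (tInr a L) M N) 0 (subst1 N L)
| st_fst (a b : ty) (M : tm nil a) (N : tm nil b) : step (tFst (tPair M N)) 0 M
| st_snd (a b : ty) (M : tm nil a) (N : tm nil b) : step (tSnd (tPair M N)) 0 N
| st_unfold (a : ty) (M : tm nil (unroll a)) : step (tUnfold (tFold a M)) 1 M
| st_app (a b : ty) (M1 M2 : tm nil (TArr a b)) (N : tm nil a) (k : nat) :
    step M1 k M2 -> step (tApp M1 N) k (tApp M2 N)
| st_case (a b t : ty) (L1 L2 : tm nil (TSum a b)) (M : tm [a] t) (N : tm [b] t) (k : nat) :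
    step L1 k L2 -> step (tCase L1 M N) k (tCase L2 M N)
| st_fstE (a b : ty) (M1 M2 : tm nil (TProd a b)) (k : nat) :
    step M1 k M2 -> step (tFst M1) k (tFst M2)
| st_sndE (a b : ty) (M1 M2 : tm nil (TProd a b)) (k : nat) :
    step M1 k M2 -> step (tSnd M1) k (tSnd M2)
| st_unfoldE (a : ty) (M1 M2 : tm nil (TMu a)) (k : nat) :
    step M1 k M2 -> step (tUnfold M1) k (tUnfold M2).

(* A model of the guarded-recursion primitives of GDTT used in the paper:
   later, next, later-application with its computation rule, the fixed
   point combinator with its unfolding, the guarded recursive type
   L A = A + |> L A, and the interpretation of closed FPC types as a
   solution of the guarded recursive type equations of the paper.
   (Type equalities of the extensional theory become propositional
   equalities of types here; we cast along them.) *)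
Record GModel : Type := {
  later : Type -> Type;
  next : forall A : Type, A -> later A;
  lap : forall A B : Type, later (A -> B) -> later A -> later B;
  lap_next : forall (A B : Type) (f : A -> B) (x : A),
      lap A B (next (A -> B) f) (next A x) = next B (f x);
  gfix : forall A : Type, (later A -> A) -> A;
  gfix_eq : forall (A : Type) (f : later A -> A), gfix A f = f (next A (gfix A f));
  LL : Type -> Type;
  L_in : forall A : Type, A + later (LL A) -> LL A;
  L_out : forall A : Type, LL A -> A + later (LL A);
  L_out_in : forall (A : Type) (x : A + later (LL A)), L_out A (L_in A x) = x;
  L_in_out : forall (A : Type) (x : LL A), L_in A (L_out A x) = x;
  Den : ty -> Type;
  Den_var : forall n, Den (TVar n) = unit;  (* irrelevant: only closed types are used *)
  Den_unit : Den TUnit = LL unit;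
  Den_sum : forall a b, Den (TSum a b) = LL (Den a + Den b);
  Den_prod : forall a b, Den (TProd a b) = (Den a * Den b)%type;
  Den_arr : forall a b, Den (TArr a b) = (Den a -> Den b);
  Den_mu : forall a, Den (TMu a) = later (Den (unroll a))
}.

Arguments next {g A}.
Arguments lap {g A B}.
Arguments gfix {g A}.
Arguments L_in {g A}.
Arguments L_out {g A}.

Definition cast {A B : Type} (e : A = B) (x : A) : B :=
  match e in _ = C return C with eq_refl => x end.

Section Semantics.
Variable g : GModel.

Local Notation D := (Den g).
Local Notation "|> A" := (later g A) (at level 60).

Definition eta {A : Type} (a : A) : LL g A := L_in (inl a).
Definition thetaL {A : Type} (r : |> LL g A) : LL g A := L_in (inr r).

Definition lmap {A B : Type} (f : A -> B) (x : |> A) : |> B := lap (next f) x.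

Definition ThetaT : Type := forall s : ty, |> D s -> D s.

(* theta_sigma, defined by guarded recursion (needed for the mu case) *)
Definition theta_body (rec : |> ThetaT) : ThetaT :=
  fix go (s : ty) : |> D s -> D s :=
    match s as s0 return |> D s0 -> D s0 with
    | TVar n => fun _ => cast (eq_sym (Den_var g n)) tt
    | TUnit => fun x =>
        cast (eq_sym (Den_unit g)) (thetaL (cast (f_equal (later g) (Den_unit g)) x))
    | TSum a b => fun x =>
        cast (eq_sym (Den_sum g a b)) (thetaL (cast (f_equal (later g) (Den_sum g a b)) x))
    | TProd a b => fun x =>
        let y := cast (f_equal (later g) (Den_prod g a b)) x in
        cast (eq_sym (Den_prod g a b))
          (go a (lap (next (@fst (D a) (D b))) y), go b (lap (next (@snd (D a) (D b))) y))
    | TArr a b => fun x =>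
        let f := cast (f_equal (later g) (Den_arr g a b)) x in
        cast (eq_sym (Den_arr g a b)) (fun v => go b (lap f (next v)))
    | TMu a => fun x =>
        let y := cast (f_equal (later g) (Den_mu g a)) x in
        cast (eq_sym (Den_mu g a))
          (lap (lmap (fun th : ThetaT => th (unroll a)) rec) y)
    end.

Definition theta : ThetaT := gfix theta_body.

Definition delta (s : ty) (x : D s) : D s := theta s (next x).
Definition delta_pow (s : ty) (k : nat) (x : D s) : D s := Nat.iter k (delta s) x.

Definition hat {A B : Type} (thB : |> B -> B) (f : A -> B) : LL g A -> B :=
  gfix (fun rec l => match L_out l with
                     | inl a => f a
                     | inr r => thB (lap rec r)
                     end).

Fixpoint env (G : list ty) : Type :=
  match G with
  | nil => unit
  | s :: G' => (D s * env G')%type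
  end.

Fixpoint lookup {G : list ty} {t : ty} (v : var G t) : env G -> D t :=
  match v in var G t return env G -> D t with
  | @Vz _ _ => fun e => fst e
  | @Vs _ _ _ v' => fun e => lookup v' (snd e)
  end.

Fixpoint sem {G : list ty} {t : ty} (M : tm G t) : env G -> D t :=
  match M in tm _ t return env G -> D t with
  | tUnit => fun _ => cast (eq_sym (Den_unit g)) (eta tt)
  | tVar v => fun e => lookup v e
  | @tInl _ a b M => fun e =>
      cast (eq_sym (Den_sum g a b)) (eta (inl (sem M e)))
  | @tInr _ a b M => fun e =>
      cast (eq_sym (Den_sum g a b)) (eta (inr (sem M e)))
  | @tCase _ a b t L M N => fun e =>
      hat (theta t)
        (fun u : D a + D b => match u with
                              | inl x => sem M (x, e)
                              | inr y => sem N (y, e)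
                              end)
        (cast (Den_sum g a b) (sem L e))
  | @tPair _ a b M N => fun e =>
      cast (eq_sym (Den_prod g a b)) (sem M e, sem N e)
  | @tFst _ a b M => fun e => fst (cast (Den_prod g a b) (sem M e))
  | @tSnd _ a b M => fun e => snd (cast (Den_prod g a b) (sem M e))
  | @tLam _ a b M => fun e =>
      cast (eq_sym (Den_arr g a b)) (fun x => sem M (x, e))
  | @tApp _ a b M N => fun e => (cast (Den_arr g a b) (sem M e)) (sem N e)
  | @tFold _ a M => fun e => cast (eq_sym (Den_mu g a)) (next (sem M e))
  | @tUnfold _ a M => fun e => theta (unroll a) (cast (Den_mu g a) (sem M e))
  end.

End Semantics.

(* Main.v *)
(* Beta and case reduction hold by the substitution lemma (and
   [hat f (eta a) = f a]); [unfold (fold M) ->^1 M] costs exactly one [delta]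
   since [theta (next x)] is [delta x].  For the congruence rules it suffices
   that every evaluation-context former commutes with [delta]: unfolding the
   guarded fixed point [theta] once shows that [delta] acts pointwise at
   arrow and product types, as [thetaL (next _)] at sum types (which [hat]
   turns into [delta]) and as [next (theta _)] at recursive types. *)
Require Import Defs.
From Stdlib Require Import List PeanoNat FunctionalExtensionality.
Import ListNotations.

Lemma castK {A B : Type} (e : A = B) (x : B) : cast e (cast (eq_sym e) x) = x.
Proof. destruct e; reflexivity. Qed.

Lemma var_cons_ind (s : ty) (G : list ty) (P : forall t, var (s :: G) t -> Prop) :
  P s (Vz G s) -> (forall t w, P t (Vs G s t w)) -> forall t v, P t v.
Proof.
  intros hz hs t v.
  exact (match v as v0 in var L t0
           return (match L as L0 return var L0 t0 -> Prop with
                   | nil => fun _ => True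
                   | s' :: G' => fun v1 => forall P' : forall t, var (s' :: G') t -> Prop,
                         P' s' (Vz G' s') -> (forall t w, P' t (Vs G' s' t w)) -> P' t0 v1
                   end) v0
         with
         | Vz _ _ => fun _ hz _ => hz
         | Vs _ _ t' w => fun _ _ hs => hs t' w
         end P hz hs).
Qed.

Section Soundness.
Variable g : GModel.

Lemma cast_next {A B : Type} (e : A = B) (x : A) :
  cast (f_equal (later g) e) (next x) = next (cast e x).
Proof. destruct e; reflexivity. Qed.

Lemma theta_unfold (s : ty) : theta g s = theta_body g (next (theta g)) s.
Proof. exact (f_equal (fun th => th s) (gfix_eq g (ThetaT g) (theta_body g))). Qed.

Lemma hat_eta {A B : Type} (thB : later g B -> B) (f : A -> B) (a : A) :
  hat g thB f (eta g a) = f a.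
Proof. unfold hat at 1. rewrite gfix_eq. unfold eta. rewrite L_out_in. reflexivity. Qed.

Lemma hat_thetaL_next {A B : Type} (thB : later g B -> B) (f : A -> B) (l : LL g A) :
  hat g thB f (thetaL g (next l)) = thB (next (hat g thB f l)).
Proof.
  unfold hat at 1. rewrite gfix_eq. unfold thetaL. rewrite L_out_in, lap_next.
  reflexivity.
Qed.

Lemma delta_arr (a b : ty) (f : Den g (TArr a b)) (x : Den g a) :
  cast (Den_arr g a b) (delta g (TArr a b) f) x = delta g b (cast (Den_arr g a b) f x).
Proof.
  unfold delta. rewrite (theta_unfold (TArr a b)). cbn [theta_body].
  rewrite castK, cast_next, lap_next, <- theta_unfold. reflexivity.
Qed.

Lemma delta_prod (a b : ty) (p : Den g (TProd a b)) :
  cast (Den_prod g a b) (delta g (TProd a b) p)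
  = (delta g a (fst (cast (Den_prod g a b) p)), delta g b (snd (cast (Den_prod g a b) p))).
Proof.
  unfold delta. rewrite (theta_unfold (TProd a b)). cbn [theta_body].
  rewrite castK, cast_next, !lap_next, <- !theta_unfold. reflexivity.
Qed.

Lemma delta_fst (a b : ty) (p : Den g (TProd a b)) :
  fst (cast (Den_prod g a b) (delta g (TProd a b) p))
  = delta g a (fst (cast (Den_prod g a b) p)).
Proof. rewrite delta_prod. reflexivity. Qed.

Lemma delta_snd (a b : ty) (p : Den g (TProd a b)) :
  snd (cast (Den_prod g a b) (delta g (TProd a b) p))
  = delta g b (snd (cast (Den_prod g a b) p)).
Proof. rewrite delta_prod. reflexivity. Qed.

Lemma delta_sum (a b : ty) (l : Den g (TSum a b)) :
  cast (Den_sum g a b) (delta g (TSum a b) l) = thetaL g (next (cast (Den_sum g a b) l)).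
Proof.
  unfold delta. rewrite (theta_unfold (TSum a b)). cbn [theta_body].
  rewrite castK, cast_next. reflexivity.
Qed.

Lemma delta_hat_sum (a b t : ty) (f : Den g a + Den g b -> Den g t) (l : Den g (TSum a b)) :
  hat g (theta g t) f (cast (Den_sum g a b) (delta g (TSum a b) l))
  = delta g t (hat g (theta g t) f (cast (Den_sum g a b) l)).
Proof. rewrite delta_sum, hat_thetaL_next. reflexivity. Qed.

Lemma delta_mu (a : ty) (x : Den g (TMu a)) :
  cast (Den_mu g a) (delta g (TMu a) x) = next (theta g (unroll a) (cast (Den_mu g a) x)).
Proof.
  unfold delta. rewrite (theta_unfold (TMu a)). cbn [theta_body].
  rewrite castK, cast_next. unfold lmap. rewrite !lap_next. reflexivity.
Qed.

Lemma delta_unfold (a : ty) (x : Den g (TMu a)) :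
  theta g (unroll a) (cast (Den_mu g a) (delta g (TMu a) x))
  = delta g (unroll a) (theta g (unroll a) (cast (Den_mu g a) x)).
Proof. rewrite delta_mu. reflexivity. Qed.

Lemma delta_pow_natural (s t : ty) (f : Den g s -> Den g t) :
  (forall x, f (delta g s x) = delta g t (f x)) ->
  forall k x, f (delta_pow g s k x) = delta_pow g t k (f x).
Proof. exact (Nat.iter_swap_gen _ _ f _ _). Qed.

Lemma sem_rename (G : list ty) (t : ty) (M : tm G t) :
  forall (D : list ty) (r : ren G D) (e : env g D) (e' : env g G),
  (forall t v, lookup g (r t v) e = lookup g v e') ->
  sem g (rename r M) e = sem g M e'.
Proof.
  induction M; intros D0 r e e' He; cbn; try reflexivity;
    try (rewrite ?(IHM _ _ _ _ He), ?(IHM1 _ _ _ _ He), ?(IHM2 _ _ _ _ He); reflexivity).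
  - apply He.
  - rewrite (IHM1 _ _ _ _ He). f_equal. apply functional_extensionality. intros [x|y].
    + apply IHM2. apply var_cons_ind; [reflexivity | intros; apply He].
    + apply IHM3. apply var_cons_ind; [reflexivity | intros; apply He].
  - f_equal. apply functional_extensionality. intros x.
    apply IHM. apply var_cons_ind; [reflexivity | intros; apply He].
Qed.

Lemma sem_weaken (G : list ty) (s t : ty) (M : tm G t) (x : Den g s) (e : env g G) :
  sem g (rename (fun _ w => Vs G s _ w) M) (x, e) = sem g M e.
Proof. apply sem_rename. reflexivity. Qed.

Lemma lookup_lift_sub (G D : list ty) (s : ty) (sg : sub G D) (e : env g D) (e' : env g G)
  (x : Den g s) :
  (forall t v, sem g (sg t v) e = lookup g v e') ->
  forall t v, sem g (lift_sub s sg t v) (x, e) = lookup g v (x, e').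
Proof.
  intros He. apply var_cons_ind; [reflexivity |].
  intros t w. cbn. rewrite sem_weaken. apply He.
Qed.

Lemma sem_subst (G : list ty) (t : ty) (M : tm G t) :
  forall (D : list ty) (sg : sub G D) (e : env g D) (e' : env g G),
  (forall t v, sem g (sg t v) e = lookup g v e') ->
  sem g (subst sg M) e = sem g M e'.
Proof.
  induction M; intros D0 sg e e' He; cbn; try reflexivity;
    try (rewrite ?(IHM _ _ _ _ He), ?(IHM1 _ _ _ _ He), ?(IHM2 _ _ _ _ He); reflexivity).
  - apply He.
  - rewrite (IHM1 _ _ _ _ He). f_equal. apply functional_extensionality. intros [x|y].
    + apply IHM2, lookup_lift_sub, He.
    + apply IHM3, lookup_lift_sub, He.
  - f_equal. apply functional_extensionality. intros x.
    apply IHM, lookup_lift_sub, He.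
Qed.

Lemma sem_subst1 (s t : ty) (M : tm [s] t) (N : tm nil s) :
  sem g (subst1 M N) tt = sem g M (sem g N tt, tt).
Proof. apply sem_subst. apply var_cons_ind; reflexivity. Qed.

End Soundness.

Theorem mainTheorem3 (g : GModel) (t : ty) (M N : tm nil t) (k : nat) :
  closed_tm M ->
  step M k N ->
  sem g M tt = delta_pow g t k (sem g N tt).
Proof.
  (* [Den] interprets open types too. *)
  intros _ Hstep. induction Hstep; cbn.
  - rewrite castK. symmetry. apply sem_subst1.
  - rewrite castK, hat_eta. symmetry. apply sem_subst1.
  - rewrite castK, hat_eta. symmetry. apply sem_subst1.
  - rewrite castK. reflexivity.
  - rewrite castK. reflexivity.
  - rewrite castK. reflexivity.
  - rewrite IHHstep. apply (delta_pow_natural g _ _ (fun f => cast (Den_arr g a b) f _)).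
    intros f. apply delta_arr.
  - rewrite IHHstep.
    apply (delta_pow_natural g _ _ (fun l => hat g (theta g t) _ (cast _ l))).
    apply delta_hat_sum.
  - rewrite IHHstep. apply (delta_pow_natural g _ _ (fun p => fst (cast _ p))).
    apply delta_fst.
  - rewrite IHHstep. apply (delta_pow_natural g _ _ (fun p => snd (cast _ p))).
    apply delta_snd.
  - rewrite IHHstep. apply (delta_pow_natural g _ _ (fun x => theta g _ (cast _ x))).
    apply delta_unfold.
Qed.
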